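(* Let $n\ge 1$ and let $f(s)=s^{n}+a_{n-1}s^{n-1}+\ldots+a_{1}s+a_{0}$ be a monic polynomial of degree $n$ with complex coefficients. Let $N_f=\{k\in\{0,\ldots,n-1\}: a_k\neq 0\}$ and $$\Lambda_f=\Big\{\{\lambda_k\}_{k\in N_f}:\ \lambda_k\in(0,1]\ \text{for } k\in N_f,\ \sum_{k\in N_f}\lambda_k\le 1\Big\}.$$ Then the following hold, where $p$ ranges over $\mathbb{Q}$: (a) if $N_f$ is non-empty and $|a_k|<1$ for every $k\in N_f$, then $f^{[p]}$ is Schur stable for every $p>p_{\max}^{\ast}$, where $$p_{\max}^{\ast}=\inf_{\{\lambda_k\}\in\Lambda_f}\ \max_{k\in N_f}\frac{\ln\lambda_k}{\ln|a_k|}\ \ge 0;$$ (b) if $N_f$ is non-empty and $|a_k|>1$ for every $k\in N_f$, then $f^{[p]}$ is Schur stable for every $p<p_{\min}^{\ast}$, where $$p_{\min}^{\ast}=\sup_{\{\lambda_k\}\in\Lambda_f}\ \min_{k\in N_f}\frac{\ln\lambda_k}{\ln|a_k|}\ \le 0;$$ (c) if $N_f$ is empty, then $f^{[p]}$ is Schur stable for every $p\in\mathbb{Q}$.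
   Context: A polynomial is Schur stable if all its zeros lie in the open unit disc $\{z\in\mathbb{C}:|z|<1\}$. For $p\in\mathbb{Q}$, the $p$-th Hadamard power of $f(s)=s^{n}+a_{n-1}s^{n-1}+\ldots+a_0$ is $f^{[p]}(s)=s^{n}+a_{n-1}^{p}s^{n-1}+\ldots+a_1^{p}s+a_{0}^{p}$, with the convention $0^p=0$ for every $p\in\mathbb{Q}$ (including $p\le 0$). If $p$ is an integer this is a single polynomial. If $p=k/m$ is a non-integer rational, with $k,m$ relatively prime integers and $m>0$, then for $a_j=|a_j|(\cos\alpha_j+i\sin\alpha_j)\neq 0$ the power $a_j^p$ is the set of the $m$ values $$a_{j,l}^{p}=|a_j|^{p}\big(\cos(p\alpha_j+2\pi l/m)+i\sin(p\alpha_j+2\pi l/m)\big),\quad l=0,\ldots,m-1,$$ i.e. the set of complex numbers whose $m$-th power is $a_j^k$. In that case $f^{[p]}$ is understood as the set of all polynomials $s^{n}+a_{n-1,l_{n-1}}^{p}s^{n-1}+\ldots+a_{1,l_1}^{p}s+a_{0,l_0}^{p}$ obtained by choosing the value of each coefficient independently (zero coefficients remain zero), and $f^{[p]}$ is called Schur stable if every polynomial in this set is Schur stable. *)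

(* Defs.v *)
From HB Require Import structures.
From mathcomp Require Export all_boot all_order all_algebra.
From mathcomp Require Export complex.
From mathcomp Require Export all_classical all_reals all_analysis.
Export Order.TTheory GRing.Theory Num.Theory numFieldNormedType.Exports.

Set Implicit Arguments.
Unset Strict Implicit.
Unset Printing Implicit Defensive.

Local Open Scope classical_set_scope.
Local Open Scope ring_scope.
Local Open Scope complex_scope.

(* The library norm `|z| on R[i] takes values in R[i]; [cmod] is the same modulus
   as an element of R. *)
Definition cmod (R : realType) (z : R[i]) : R := ComplexField.Normc.normc z.

Definition schur_stable (R : realType) (f : {poly R[i]}) : Prop :=
  forall z : R[i], root f z -> cmod z < 1.

(* All values of a ^ p, with 0 ^ p = 0 for every p, including p <= 0.  For
   non-integer p = numq p / denq p (lowest terms, denq p > 0) this is the set of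
   m = denq p values; any argument alpha of a gives the same set. *)
Definition cpow (R : realType) (p : rat) (a : R[i]) : set R[i] :=
  if a == 0 then [set 0]
  else if denq p == 1 then [set a ^ numq p]
  else [set b | exists (alpha : R) (l : nat),
         [/\ a = (cmod a)%:C * (cos alpha +i* sin alpha),
             (l < `|denq p|)%N &
             b = (cmod a `^ ratr p)%:C *
                 (cos (ratr p * alpha + 2 * pi * l%:R / (denq p)%:~R) +i*
                  sin (ratr p * alpha + 2 * pi * l%:R / (denq p)%:~R))]].

Definition degree (R : realType) (f : {poly R[i]}) : nat := (size f).-1.

(* f^[p] as a set of polynomials: the value of the p-th power is chosen
   independently for each coefficient; a singleton when p is an integer. *)
Definition hadamard_power (R : realType) (f : {poly R[i]}) (p : rat) :
    set {poly R[i]} :=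
  [set g | exists2 c : 'I_(degree f) -> R[i],
      (forall k : 'I_(degree f), cpow p f`_k (c k)) &
      g = 'X^(degree f) + \sum_(k < degree f) c k *: 'X^k].

Definition schur_stable_power (R : realType) (f : {poly R[i]}) (p : rat) : Prop :=
  forall g, hadamard_power f p g -> schur_stable g.

Definition Nf (R : realType) (f : {poly R[i]}) : {set 'I_(degree f)} :=
  [set k : 'I_(degree f) | f`_k != 0]%SET.

(* Families indexed by Nf f are encoded as functions on all indices; the values
   outside Nf f are unconstrained and never used. *)
Definition Lambda (R : realType) (f : {poly R[i]}) : set ('I_(degree f) -> R) :=
  [set lam | (forall k, k \in Nf f -> 0 < lam k <= 1) /\
             \sum_(k in Nf f) lam k <= 1].
Arguments Lambda {R} f.

Definition log_ratio (R : realType) (f : {poly R[i]}) (lam : 'I_(degree f) -> R)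
    (k : 'I_(degree f)) : R :=
  ln (lam k) / ln (cmod f`_k).
Arguments log_ratio {R} f lam k.

(* Computed in \bar R, so that the neutral elements -oo and +oo make the
   iterated max and min over a nonempty Nf f the genuine ones. *)
Definition pmax (R : realType) (f : {poly R[i]}) : \bar R :=
  ereal_inf [set (\big[maxe/-oo]_(k in Nf f) (log_ratio f lam k)%:E)%E
            | lam in Lambda f].

Definition pmin (R : realType) (f : {poly R[i]}) : \bar R :=
  ereal_sup [set (\big[mine/+oo]_(k in Nf f) (log_ratio f lam k)%:E)%E
            | lam in Lambda f].

(* Main.v *)
Require Import Defs.

(** Every coefficient of a polynomial [g] in [f^[p]] has modulus [|a_k|^p], or
    [0] where [a_k = 0], whichever branch of the power is taken
    ([cmod_cpow]).  A monic polynomial whose lower coefficients have moduli of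
    sum less than [1] is Schur stable, because at [|z| >= 1] the leading term
    strictly dominates all the others together ([monic_root_norm_lt1]).  So it
    suffices that [sum_(k in N_f) |a_k|^p < 1]; for empty [N_f] this is trivial.

    A family [lam] in [Lambda_f] certifies this as soon as [|a_k|^p < lam_k] on
    [N_f], that is [p ln |a_k| < ln lam_k]: summing the strict inequalities over
    the nonempty [N_f] gives a total below [1]
    ([schur_stable_power_of_weights]).  Dividing by [ln |a_k|] turns the
    condition into a lower bound on [p] when all [|a_k| < 1], and into an upper
    bound when all [|a_k| > 1].  The numbers [p_max] and [p_min] are the
    infimum and the supremum of the thresholds so obtained; a [p] strictly
    beyond them is beyond the threshold of some family.  Their signs follow from
    [ln lam_k <= 0]. *)

Local Open Scope classical_set_scope.
Local Open Scope ring_scope.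
Local Open Scope complex_scope.

(** If [1 <= |z|], every [|z|^k] with [k < n] is at most [|z|^n], so the lower
    terms have total modulus below [|z|^n] and cannot cancel [z^n]. *)
Lemma monic_root_norm_lt1 (K : numFieldType) (n : nat) (c : 'I_n -> K) (z : K) :
  \sum_(k < n) `|c k| < 1 ->
  root ('X^n + \sum_(k < n) c k *: 'X^k) z -> `|z| < 1.
Proof.
move=> c_lt1 /rootP; rewrite hornerD hornerXn horner_sum.
under eq_bigr do rewrite hornerZ hornerXn.
move=> /eqP; rewrite addr_eq0 => /eqP z_pow.
rewrite real_ltNge ?normr_real ?real1//; apply/negP => z_ge1.
have zn_gt0 : 0 < `|z| ^+ n by rewrite exprn_gt0// (lt_le_trans ltr01).
suff : `|z| ^+ n < `|z| ^+ n by rewrite ltxx.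
rewrite -{1}normrX z_pow normrN.
apply: (@le_lt_trans _ _ ((\sum_(k < n) `|c k|) * `|z| ^+ n)); last first.
  by rewrite gtr_pMl.
rewrite (le_trans (ler_norm_sum _ _ _))// mulr_suml ler_sum// => k _.
by rewrite normrM normrX ler_wpM2l// ler_weXn2l// ltnW.
Qed.

Section ComplexModulus.
Context {R : realType}.
Implicit Types (a b z : R[i]) (p : rat) (f : {poly R[i]}).

Lemma normE_cmod z : `|z| = (cmod z)%:C.
Proof. by []. Qed.

Lemma cmod_ge0 z : 0 <= cmod z.
Proof. by rewrite -lecR -normE_cmod normr_ge0. Qed.

Lemma cmod_gt0 z : (0 < cmod z) = (z != 0).
Proof. by rewrite -ltcR -normE_cmod normr_gt0. Qed.

Lemma cmod_exprz z (m : int) : cmod (z ^ m) = cmod z ^ m.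
Proof.
have cmodX k : cmod (z ^+ k) = cmod z ^+ k.
  elim: k => [|k IH]; first by rewrite !expr0 /cmod ComplexField.Normc.normc1.
  by rewrite !exprS /cmod ComplexField.Normc.normcM -/(cmod _) -/(cmod _) IH.
case: m => k; first exact: cmodX.
by rewrite !NegzE -!exprnN /cmod ComplexField.Normc.normcV -/(cmod _) cmodX.
Qed.

Lemma cmod_polar (r t : R) : 0 <= r ->
  cmod (r%:C * (cos t +i* sin t)) = r.
Proof.
move=> r_ge0; rewrite /cmod ComplexField.Normc.normcM /=.
by rewrite expr0n addr0 sqrtr_sqr ger0_norm// cos2Dsin2 sqrtr1 mulr1.
Qed.

(** All branches of a power share one modulus, so the choice of branch for each
    coefficient cannot affect stability; the zero coefficient must be set
    apart, because [0 `^ 0 = 1] whereas the convention here is [0 ^ 0 = 0]. *)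
Lemma cmod_cpow p a b : cpow p a b ->
  cmod b = if a == 0 then 0 else cmod a `^ ratr p.
Proof.
rewrite /cpow; case: eqVneq => [_ ->|a_neq0].
  by rewrite /cmod ComplexField.Normc.normc0.
case: eqP => [p_int ->|_ [t [l [_ _ ->]]]]; last exact/cmod_polar/powR_ge0.
rewrite cmod_exprz -powR_intmul ?cmod_ge0//; congr (_ `^ _).
by rewrite -[p in RHS]divq_num_den p_int divr1 ratr_int.
Qed.

(** The zero coefficients drop out of the sum, so the bound is on [Nf f] only;
    for empty [Nf f] it holds for every [p]. *)
Lemma schur_stable_power_of_sum f p :
  \sum_(k in Nf f) cmod f`_k `^ ratr p < 1 -> schur_stable_power f p.
Proof.
move=> sum_lt1 g [c c_pow ->] z /monic_root_norm_lt1 z_lt1.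
rewrite -ltcR -normE_cmod; apply: z_lt1.
under eq_bigr do rewrite normE_cmod.
rewrite -rmorph_sum ltcR (le_lt_trans _ sum_lt1)// [leRHS]big_mkcond/=.
apply: ler_sum => k _.
by rewrite (cmod_cpow _ _ _ (c_pow k)) inE; case: eqVneq.
Qed.

(** Multiplied out, the condition on [p] no longer depends on the sign of
    [ln |a_k|], so it serves both [|a_k| < 1] and [|a_k| > 1].  The index set
    must be nonempty: [Lambda] only gives a sum at most [1], and it is a strict
    gap at some index that brings the total below [1]. *)
Lemma schur_stable_power_of_weights f p (lam : 'I_(degree f) -> R) :
  Nf f <> finset.set0 -> Lambda f lam ->
  (forall k, k \in Nf f -> ratr p * ln (cmod f`_k) < ln (lam k)) ->
  schur_stable_power f p.
Proof.
move=> /eqP/set0Pn[k0 k0N] [lam01 lam_sum] lt_ln.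
apply: schur_stable_power_of_sum; apply: lt_le_trans lam_sum.
have lt_lam k : k \in Nf f -> cmod f`_k `^ ratr p < lam k.
  move=> kN; have /andP[lam_gt0 _] := lam01 k kN.
  have a_gt0 : 0 < cmod f`_k by move: kN; rewrite inE cmod_gt0.
  by rewrite -ltr_ln ?posrE ?powR_gt0// ln_powR lt_ln.
apply: ltr_sum => //; apply/hasP; exists k0 => //; exact: mem_index_enum.
Qed.

End ComplexModulus.

Theorem theorem1 (R : realType) (f : {poly R[i]})
    (f_monic : f \is monic) (f_deg : (1 <= degree f)%N) :
  [/\ (Nf f <> finset.set0 ->
       (forall k : 'I_(degree f), k \in Nf f -> cmod f`_k < 1) ->
       (0 <= pmax f)%E /\
       forall p : rat, (pmax f < (ratr p)%:E)%E -> schur_stable_power f p),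
      (Nf f <> finset.set0 ->
       (forall k : 'I_(degree f), k \in Nf f -> 1 < cmod f`_k) ->
       (pmin f <= 0)%E /\
       forall p : rat, ((ratr p)%:E < pmin f)%E -> schur_stable_power f p)
    & (Nf f = finset.set0 -> forall p : rat, schur_stable_power f p)].
Proof.
split=> [Nf_neq0 a_lt1|Nf_neq0 a_gt1|Nf0 p].
- have ln_a_lt0 k : k \in Nf f -> ln (cmod f`_k) < 0.
    move=> kN; apply: ln_lt0; rewrite a_lt1// andbT.
    by move: kN; rewrite inE cmod_gt0.
  split=> [|p /ereal_inf_lt[_ [lam lamL <-]] /bigmax_ltP[_ lt_p]].
    apply/ereal_infP => _ [lam [lam01 _] <-].
    have /eqP/set0Pn[k kN] := Nf_neq0; have /andP[_ lam_le1] := lam01 k kN.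
    apply: le_trans (le_bigmax_cond _ _ kN).
    by rewrite lee_fin /log_ratio mulr_le0// ?ln_le0// invr_le0 ltW// ln_a_lt0.
  apply: schur_stable_power_of_weights lamL _ => // k kN.
  by rewrite -ltr_ndivrMr ?ln_a_lt0// -lte_fin lt_p.
- have ln_a_gt0 k : k \in Nf f -> 0 < ln (cmod f`_k).
    by move=> kN; rewrite ln_gt0// a_gt1.
  split=> [|p /ereal_sup_gt[_ [lam lamL <-]] /bigmin_gtP[_ p_lt]].
    apply/ereal_supP => _ [lam [lam01 _] <-].
    have /eqP/set0Pn[k kN] := Nf_neq0; have /andP[_ lam_le1] := lam01 k kN.
    apply: le_trans (bigmin_le_cond _ _ kN) _.
    by rewrite lee_fin /log_ratio mulr_le0_ge0// ?ln_le0// invr_ge0 ltW// ln_a_gt0.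
  apply: schur_stable_power_of_weights lamL _ => // k kN.
  by rewrite -ltr_pdivlMr ?ln_a_gt0// -lte_fin p_lt.
- by apply: schur_stable_power_of_sum; rewrite Nf0 big_set0.
Qed.
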